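(* Let $H=K_{k_1}\Box\cdots\Box K_{k_n}$ be a Hamming graph with root $0^n$, and let $G=H_{0^n}(\{x,y\})$ be the daisy graph of $H$ with respect to $0^n$ generated by a set $\{x,y\}$ of two distinct vertices. Then $G$ is an isometric subgraph of $H$ if and only if there exists a pseudo-median of $(x,y,0^n)$ of size $0$ or $1$ in $G$.
   Context: $V(H)=\prod_{i=1}^n\{0,\dots,k_i-1\}$, two vertices adjacent iff they differ in exactly one coordinate; $0^n$ is the all-zero vertex. Intervals: $I_H(a,b)=\{z: d(a,z)+d(z,b)=d(a,b)\}$. For $X\subseteq V(H)$, $H_{0^n}(X)$ is the subgraph of $H$ induced by $\bigcup_{v\in X}I_H(0^n,v)$. A subgraph is isometric if it preserves distances. In a graph, a triple $(a,b,c)$ is a pseudo-median of $(u,v,w)$ if: (1) some shortest $u,v$-path contains $a,b$, some shortest $v,w$-path contains $b,c$, some shortest $u,w$-path contains $a,c$; (2) $d(a,b)=d(b,c)=d(a,c)$; (3) $d(a,b)$ is minimal subject to (1),(2). Its size is $d(a,b)$.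
   Formalization: The pseudo-median of (x,y,0^n) is taken with shortest paths, distances and minimality of H, with its vertices required to lie in G; measured inside G itself the claim fails, e.g. for K_3□K_3 with x=(1,1), y=(2,2). *)

(* Defs.v *)
From mathcomp Require Export all_boot.

Set Implicit Arguments.
Unset Strict Implicit.
Unset Printing Implicit Defensive.

(* A finite simple graph is a symmetric irreflexive relation [e] on a finType. *)
Section Graph.
Variables (T : finType) (e : rel T).

Definition has_walk (u v : T) (m : nat) : bool :=
  [exists p : m.-tuple T, path e u p && (last u p == v)].

(* The least length of a walk from [u] to [v].  If there is none the value is
   #|T|, which plays the role of infinity: finite distances are < #|T|.
   Hamming graphs and daisy graphs are connected, so this does not occur there. *)
Definition gdist (u v : T) : nat := find (has_walk u v) (iota 0 #|T|).

Definition interval (a b : T) : {set T} :=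
  [set z | gdist a z + gdist z b == gdist a b].

(* The path is u :: p. *)
Definition shortest_path (u v : T) (p : seq T) : Prop :=
  [/\ path e u p, last u p = v & size p = gdist u v].

Definition on_shortest_path (u v a b : T) : Prop :=
  exists p, [/\ shortest_path u v p, a \in u :: p & b \in u :: p].

Definition pseudo_median_candidate (u v w a b c : T) : Prop :=
  [/\ on_shortest_path u v a b,
      on_shortest_path v w b c,
      on_shortest_path u w a c &
      gdist a b = gdist b c /\ gdist b c = gdist a c].

Definition pseudo_median (u v w a b c : T) : Prop :=
  pseudo_median_candidate u v w a b c /\
  (forall a' b' c', pseudo_median_candidate u v w a' b' c' ->
     gdist a b <= gdist a' b').

(* Vertex set of the daisy graph with root [r] generated by [X]. *)
Definition daisy (r : T) (X : {set T}) : {set T} :=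
  \bigcup_(v in X) interval r v.

Definition induced (S : {set T}) : rel {z : T | z \in S} :=
  fun u v => e (val u) (val v).

End Graph.

Definition isometric (T : finType) (e : rel T) (S : {set T}) : Prop :=
  forall u v : {z : T | z \in S},
    gdist (@induced T e S) u v = gdist e (val u) (val v).

Definition hvertex (n : nat) (k : 'I_n -> nat) : finType :=
  {dffun forall i : 'I_n, 'I_(k i)}.

Definition hamming (n : nat) (k : 'I_n -> nat) : rel (hvertex k) :=
  fun u v => #|[set i : 'I_n | u i != v i]| == 1.

Definition hroot (n : nat) (k : 'I_n -> nat) (k_gt0 : forall i, 0 < k i) :
  hvertex k := [ffun i : 'I_n => Ordinal (k_gt0 i)].

(* Main.v *)
(** In a Hamming graph distances count differing coordinates and intervals are
    boxes, so [G] is the union of the boxes spanned by the root [r] with [x] and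
    with [y].  Let [t] be the number of coordinates at which [x], [y], [r] are
    pairwise distinct.  There the three vertices of a pseudo-median candidate
    agree with [x], [y], [r] respectively, and taking the majority value at all
    other coordinates gives a candidate of size exactly [t]; so pseudo-medians
    have size [t].
    If [t >= 2], let [u] and [v] agree with [x] resp. [y] at these [t]
    coordinates and with [r] elsewhere: every neighbour of [u] on a geodesic to
    [v] mixes values of [x] and [y] and leaves [G].  If [t <= 1], a geodesic in
    [G] from the box of [x] to the box of [y] first moves towards [r] where the
    target equals [r], then crosses the at most one exceptional coordinate, and
    finally moves away from [r]. *)
Require Import Defs.
From mathcomp Require Import all_boot.

Set Implicit Arguments.
Unset Strict Implicit.
Unset Printing Implicit Defensive.

(** * Walks and distances in finite graphs *)

Section Walks.
Variables (T : finType) (e : rel T).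
Implicit Types (u v w a b : T) (m : nat).

Lemma has_walkP u v m :
  reflect (exists p, [/\ path e u p, last u p = v & size p = m])
          (has_walk e u v m).
Proof.
apply: (iffP existsP) => [[p /andP[pp /eqP pl]]|[p [pp pl /eqP ps]]].
  by exists p; rewrite size_tuple.
by exists (Tuple ps); rewrite /= pp pl eqxx.
Qed.

Lemma has_walk0 u : has_walk e u u 0.
Proof. by apply/has_walkP; exists [::]. Qed.

Lemma has_walk_cat u v w m1 m2 :
  has_walk e u v m1 -> has_walk e v w m2 -> has_walk e u w (m1 + m2).
Proof.
move=> /has_walkP[p [pp pl ps]] /has_walkP[q [qp ql qs]]; apply/has_walkP.
by exists (p ++ q); rewrite cat_path last_cat size_cat pp pl qp ql ps qs.
Qed.

Lemma has_walk1 u v : e u v -> has_walk e u v 1.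
Proof. by move=> uv; apply/has_walkP; exists [:: v]; rewrite /= uv. Qed.

(** Removing cycles from a walk leaves distinct vertices, hence fewer than [#|T|] steps. This brings
    a witness into the range that [gdist] searches. *)
Lemma has_walk_short u v m :
  has_walk e u v m -> exists m', [/\ m' <= m, m' < #|T| & has_walk e u v m'].
Proof.
move=> /has_walkP[p [pp pl ps]].
case: (shortenP pp) pl => q qp uq sub ql.
exists (size q); split; last by apply/has_walkP; exists q.
  by rewrite -ps; apply: uniq_leq_size => //; case/andP: uq.
by move/card_uniqP: uq => /= <-; apply: max_card.
Qed.

Lemma has_walk_gdist u v m : has_walk e u v m -> has_walk e u v (gdist e u v).
Proof.
move=> /has_walk_short[m' [_ ltm wm']].
have hw : has (has_walk e u v) (iota 0 #|T|).
  by apply/hasP; exists m' => //; rewrite mem_iota.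
have := nth_find 0 hw; rewrite nth_iota //.
by move: hw; rewrite has_find size_iota.
Qed.

Lemma gdist_min u v m : has_walk e u v m -> gdist e u v <= m.
Proof.
move=> /has_walk_short[m' [lem ltm wm']]; apply: leq_trans lem.
rewrite leqNgt; apply/negP => lt; have := before_find 0 lt.
by rewrite nth_iota // wm'.
Qed.

Lemma gdist_eq u v m :
  has_walk e u v m -> (forall m', has_walk e u v m' -> m <= m') ->
  gdist e u v = m.
Proof.
by move=> wm min; apply/eqP; rewrite eqn_leq gdist_min // min // (has_walk_gdist wm).
Qed.

Lemma on_shortest_path_cat u v a b m1 m2 m3 :
  has_walk e u a m1 -> has_walk e a b m2 -> has_walk e b v m3 ->
  m1 + m2 + m3 = gdist e u v -> on_shortest_path e u v a b.
Proof.
move=> /has_walkP[p [pp pl ps]] /has_walkP[q [qp ql qs]].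
move=> /has_walkP[s [sp sl ss]] len.
exists (p ++ q ++ s); split; first split.
- by rewrite !cat_path pp pl qp ql.
- by rewrite !last_cat pl ql.
- by rewrite !size_cat ps qs ss addnA.
- by rewrite -cat_cons mem_cat -pl mem_last.
- by rewrite catA -cat_cons mem_cat -ql -pl -last_cat mem_last.
Qed.

Lemma mem_shortest_path u v p a :
  shortest_path e u v p -> a \in u :: p ->
  exists m1 m2, [/\ has_walk e u a m1, has_walk e a v m2 & m1 + m2 = gdist e u v].
Proof.
move=> [pp pl ps] ap; case/splitPl: ap pp pl ps => p1 p2 p1l.
rewrite cat_path last_cat size_cat p1l => /andP[pp1 pp2] p2l ps.
by exists (size p1), (size p2); split=> //; apply/has_walkP;
  [exists p1 | exists p2].
Qed.

End Walks.

Lemma has_walk_induced (T : finType) (e : rel T) (S : {set T}) (u v : {z : T | z \in S}) m :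
  has_walk (@induced T e S) u v m -> has_walk e (val u) (val v) m.
Proof.
move=> /has_walkP[p [pp pl ps]]; apply/has_walkP; exists (map val p).
by rewrite path_map last_map size_map pl.
Qed.

(** * Distances and intervals in Hamming graphs *)

Section Hamming.
Variables (n : nat) (k : 'I_n -> nat).
Local Notation V := (hvertex k).
Local Notation H := (@hamming n k).
Implicit Types (u v w z x y r a b c : V).

Definition hdist u v : nat := \sum_i (u i != v i).

Lemma card_hdist u v : #|[set i | u i != v i]| = hdist u v.
Proof.
rewrite cardsE -sum1_card big_mkcond; apply: eq_bigr => i _.
by rewrite unfold_in; case: eqP.
Qed.

Lemma hamming_hdist u v : H u v = (hdist u v == 1).
Proof. by rewrite /hamming card_hdist. Qed.

(** The inequality holds in each coordinate, so equality of the sums means equality in every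
    coordinate. This is why intervals are boxes. *)
Lemma hdist_triangle_leqif u z v :
  hdist u v <= hdist u z + hdist z v
    ?= iff [forall i, (z i == u i) || (z i == v i)].
Proof.
rewrite -big_split; apply: leqif_sum => i _.
have [->|zu] := eqVneq (z i) (u i); first by split; rewrite ?eqxx.
have [<-|_] := eqVneq (z i) (v i); first by rewrite eq_sym zu; split.
by split; case: (u i == v i).
Qed.

Lemma hdist_triangle u z v : hdist u v <= hdist u z + hdist z v.
Proof. exact: hdist_triangle_leqif. Qed.

Lemma hdist_between u z v :
  reflect (forall i, z i = u i \/ z i = v i)
          (hdist u z + hdist z v == hdist u v).
Proof.
rewrite eq_sym (hdist_triangle_leqif u z v).2.
apply: (iffP forallP) => h i; first by case/orP: (h i) => /eqP->; [left|right].
by case: (h i) => ->; rewrite eqxx ?orbT.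
Qed.

Lemma hdist_eq0 u v : hdist u v = 0 -> u = v.
Proof.
move=> /eqP; rewrite sum_nat_eq0 => /forallP h; apply/ffunP => i.
by apply/eqP; have := h i; case: (u i == v i).
Qed.

Lemma hdist_walk u v m : has_walk H u v m -> hdist u v <= m.
Proof.
move=> /has_walkP[p [pp pl <-]]; elim: p u pp pl => [|z p IH] u /=.
  by move=> _ ->; rewrite /hdist big1 // => i _; rewrite eqxx.
rewrite hamming_hdist => /andP[/eqP uz pp] pl.
by apply: leq_trans (hdist_triangle u z v) _; rewrite uz add1n ltnS IH.
Qed.

Lemma hamming_step u v m :
  hdist u v = m.+1 ->
  exists z, [/\ forall i, z i = u i \/ z i = v i, hdist u z = 1 & hdist z v = m].
Proof.
move=> uv.
have /existsP[i ui] : [exists i, u i != v i].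
  apply/contraT; rewrite negb_exists => /forallP h.
  by move: uv; rewrite /hdist big1 // => j _; have := h j; case: eqP.
pose z : V := [ffun j : 'I_n => if j == i then v j else u j].
have bz j : z j = u j \/ z j = v j.
  by rewrite ffunE; case: eqP => _; [right|left].
have uz : hdist u z = 1.
  rewrite /hdist (bigD1 i) //= big1 ?addn0 => [|j ji]; rewrite ffunE ?eqxx ?ui //.
  by rewrite (negbTE ji) eqxx.
exists z; split=> //; move/hdist_between/eqP: bz; by rewrite uz uv => -[].
Qed.

(** Changing one differing coordinate at a time to its value in [v] gives a geodesic inside the box
    between [u] and [v]. The box from the next vertex to [v] is contained in the old one, so the
    induction goes through. *)
Lemma box_walk (S : {set V}) (u v : {z : V | z \in S}) :
  (forall z, (forall i, z i = val u i \/ z i = val v i) -> z \in S) ->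
  has_walk (@induced _ H S) u v (hdist (val u) (val v)).
Proof.
move Em: (hdist _ _) => m; elim: m u Em => [|m IH] u Em box.
  by rewrite (val_inj (hdist_eq0 Em)); apply: has_walk0.
have [z [bz uz zv]] := hamming_step Em.
pose z' : {z : V | z \in S} := Sub z (box z bz).
rewrite -add1n; apply: (@has_walk_cat _ _ _ z').
  by apply: has_walk1; rewrite /induced hamming_hdist uz.
apply: IH => // w bw; apply: (box) => i.
by case: (bw i) => -> /=; [apply: bz | right].
Qed.

Lemma hamming_walk u v : has_walk H u v (hdist u v).
Proof.
pose s w : {z : V | z \in [set: V]} := Sub w (in_setT w).
exact: has_walk_induced (@box_walk _ (s u) (s v) (fun z _ => in_setT z)).
Qed.

Lemma gdist_hamming u v : gdist H u v = hdist u v.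
Proof. by apply: gdist_eq => [|m]; [apply: hamming_walk | apply: hdist_walk]. Qed.

Lemma mem_interval_hamming r v z :
  reflect (forall i, z i = r i \/ z i = v i) (z \in interval H r v).
Proof. by rewrite inE !gdist_hamming; apply: hdist_between. Qed.

Lemma on_shortest_path_hamming u v a b :
  hdist u a + hdist a b + hdist b v = hdist u v -> on_shortest_path H u v a b.
Proof.
move=> len; apply: on_shortest_path_cat (hamming_walk u a) (hamming_walk a b)
  (hamming_walk b v) _.
by rewrite gdist_hamming.
Qed.

Lemma on_shortest_path_box u v a b :
  on_shortest_path H u v a b ->
  forall i, (a i = u i \/ a i = v i) /\ (b i = u i \/ b i = v i).
Proof.
have box p c : shortest_path H u v p -> c \in u :: p ->
    forall i, c i = u i \/ c i = v i.
  move=> sp cp; have [m1 [m2 [/hdist_walk w1 /hdist_walk w2]]] := mem_shortest_path sp cp.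
  rewrite gdist_hamming => len; apply/hdist_between.
  by rewrite eqn_leq hdist_triangle andbT -len leq_add.
by move=> [p [sp ap bp]] i; split; [apply: (box p a) | apply: (box p b)].
Qed.

(** * Size of pseudo-medians *)

Definition tri r x y : {set 'I_n} :=
  [set i | [&& x i != y i, x i != r i & y i != r i]].

Lemma card_tri r x y :
  #|tri r x y| = \sum_i [&& x i != y i, x i != r i & y i != r i].
Proof.
rewrite cardsE -sum1_card big_mkcond; apply: eq_bigr => i _.
by rewrite unfold_in; case: ifP.
Qed.

(** Where [x], [y], [r] are pairwise distinct, [a] lies in the boxes of [x, y] and of [x, r], which
    share only the value of [x]; likewise [b] has the value of [y]. So [a] and [b] differ there. *)
Lemma candidate_size_ge r x y a b c :
  pseudo_median_candidate H x y r a b c -> #|tri r x y| <= hdist a b.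
Proof.
move=> [/on_shortest_path_box xy /on_shortest_path_box yr
        /on_shortest_path_box xr _].
rewrite card_tri; apply: leq_sum => i _.
have [/and3P[xy' xr' yr']|//] := boolP [&& _, _ & _].
have -> : a i = x i.
  case: (xy i).1 => // ay; case: (xr i).1 => // ar.
  by rewrite -ay ar eqxx in yr'.
have -> : b i = y i.
  case: (xy i).2 => // bx; case: (yr i).1 => // br.
  by rewrite -bx br eqxx in xr'.
by rewrite xy'.
Qed.

(* The majority value where two of the arguments agree, and that of [u] where
   all three differ. *)
Definition majority u v w : V :=
  [ffun i : 'I_n => if v i == w i then v i else u i].

Lemma hdist_majority u v w :
  hdist (majority u v w) (majority v u w) = #|tri w u v|.
Proof.
rewrite card_tri; apply: eq_bigr => i _; rewrite !ffunE.
have [e1|n1] := eqVneq (v i) (w i); have [e2|n2] := eqVneq (u i) (w i).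
- by rewrite e1 e2 eqxx.
- by rewrite eqxx andbF.
- by rewrite eqxx andbF.
- by rewrite !andbT.
Qed.

Lemma majorityC u v w : majority u v w = majority u w v.
Proof. by apply/ffunP => i; rewrite !ffunE eq_sym; case: eqP => [->|]. Qed.

Lemma triC r x y : tri r y x = tri r x y.
Proof. by apply/setP => i; rewrite !inE eq_sym [X in _ && X]andbC. Qed.

Lemma tri_rot r x y : tri x y r = tri r x y.
Proof.
apply/setP => i; rewrite !inE (eq_sym (y i) (x i)) (eq_sym (r i) (x i)).
by rewrite andbC andbA.
Qed.

Lemma majority_on_shortest_path u v w :
  on_shortest_path H u v (majority u v w) (majority v u w).
Proof.
apply: on_shortest_path_hamming; rewrite -!big_split; apply: eq_bigr => i _.
rewrite /= !ffunE.
have [e1|n1] := eqVneq (v i) (w i); have [e2|n2] := eqVneq (u i) (w i).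
- by rewrite e1 e2 !eqxx.
- by rewrite !eqxx !addn0.
- by rewrite !eqxx.
- by rewrite !eqxx addn0.
Qed.

Lemma majority_candidate r x y :
  pseudo_median_candidate H x y r
    (majority x y r) (majority y x r) (majority r x y).
Proof.
split; first exact: majority_on_shortest_path.
(* The other two sides follow from the first by permuting the three vertices. *)
- by rewrite (majorityC y) (majorityC r); apply: majority_on_shortest_path.
- by rewrite (majorityC x); apply: majority_on_shortest_path.
rewrite !gdist_hamming; split.
  rewrite hdist_majority (majorityC y) (majorityC r) hdist_majority.
  by rewrite (tri_rot r x y).
rewrite (majorityC y) (majorityC r x) hdist_majority.
rewrite (majorityC x) (majorityC r) hdist_majority.
by rewrite (tri_rot r x y) (tri_rot r y x) (triC r x y).
Qed.

Lemma majority_pseudo_median r x y :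
  pseudo_median H x y r
    (majority x y r) (majority y x r) (majority r x y).
Proof.
split; first exact: majority_candidate.
by move=> a b c /candidate_size_ge; rewrite !gdist_hamming hdist_majority.
Qed.

(** * Isometry of daisy graphs with two generators *)

Lemma mem_daisy2 r x y z :
  reflect ((forall i, z i = r i \/ z i = x i) \/ (forall i, z i = r i \/ z i = y i))
          (z \in daisy H r [set x; y]).
Proof.
apply: (iffP bigcupP) => [[v]|[/mem_interval_hamming zx|/mem_interval_hamming zy]].
- by rewrite in_set2 => /orP[]/eqP-> /mem_interval_hamming; [left|right].
- by exists x; rewrite ?set21.
- by exists y; rewrite ?set22.
Qed.

Lemma daisy2C r x y : daisy H r [set y; x] = daisy H r [set x; y].
Proof. by rewrite /daisy setUC. Qed.

Lemma majority_daisy r x y :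
  [/\ majority x y r \in daisy H r [set x; y],
      majority y x r \in daisy H r [set x; y] &
      majority r x y \in daisy H r [set x; y]].
Proof.
split; apply/mem_daisy2.
- by left=> i; rewrite ffunE; case: eqP => [->|_]; [left|right].
- by right=> i; rewrite ffunE; case: eqP => [->|_]; [left|right].
- by left=> i; rewrite ffunE; case: eqP => _; [right|left].
Qed.

(** Any two vertices are joined through the root. This makes [gdist] in the daisy graph the length
    of an actual walk. *)
Lemma daisy2_connected r x y (u v : {z : V | z \in daisy H r [set x; y]}) :
  exists m, has_walk (@induced _ H _) u v m.
Proof.
have rS : r \in daisy H r [set x; y] by apply/mem_daisy2; left=> i; left.
pose r' : {z : V | z \in daisy H r [set x; y]} := Sub r rS.
exists (hdist (val u) r + hdist r (val v)); apply: (@has_walk_cat _ _ _ r').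
  apply: box_walk => z bz; apply/mem_daisy2.
  by case/mem_daisy2: (valP u) => bu; [left|right] => i; case: (bz i) => ->;
    [apply: bu | left | apply: bu | left].
apply: box_walk => z bz; apply/mem_daisy2.
by case/mem_daisy2: (valP v) => bv; [left|right] => i; case: (bz i) => ->;
  [left | apply: bv | left | apply: bv].
Qed.

Lemma isometric_tri_le1 r x y :
  isometric H (daisy H r [set x; y]) -> #|tri r x y| <= 1.
Proof.
move=> iso; rewrite leqNgt; apply/negP => t2.
pose u : V := [ffun i : 'I_n => if i \in tri r x y then x i else r i].
pose v : V := [ffun i : 'I_n => if i \in tri r x y then y i else r i].
have uS : u \in daisy H r [set x; y].
  by apply/mem_daisy2; left=> i; rewrite ffunE; case: ifP => _; [right|left].
have vS : v \in daisy H r [set x; y].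
  by apply/mem_daisy2; right=> i; rewrite ffunE; case: ifP => _; [right|left].
have uv : hdist u v = #|tri r x y|.
  rewrite card_tri; apply: eq_bigr => i _; rewrite !ffunE inE.
  by case: ifP => [/andP[->]|_]; rewrite ?eqxx.
pose u' : {z : V | z \in daisy H r [set x; y]} := Sub u uS.
pose v' : {z : V | z \in daisy H r [set x; y]} := Sub v vS.
have [m /has_walk_gdist] := daisy2_connected u' v'.
rewrite iso gdist_hamming uv => /has_walkP[[|z p] [/= pp pl ps]].
  by rewrite -ps in t2.
case/andP: pp => uz pp.
have zv : hdist (val z) v <= size p.
  apply/hdist_walk/(@has_walk_induced _ _ _ z v').
  by apply/has_walkP; exists p.
have {}uz : hdist u (val z) = 1 by apply/eqP; rewrite -hamming_hdist.
(* The first vertex [z] after [u] differs from [v] on all of [tri r x y] if it is in the box of [x],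
   and from [u] if it is in the box of [y]. The former is too far from [v], the latter too far from
   [u]. *)
case/mem_daisy2: (valP z) => bz.
  suff : #|tri r x y| <= hdist (val z) v by rewrite -ps leqNgt ltnS zv.
  rewrite card_tri; apply: leq_sum => i _; rewrite ffunE inE.
  case: ifP => [/and3P[xy xr yr]|//].
  by case: (bz i) => ->; rewrite ?xy // eq_sym yr.
suff : #|tri r x y| <= hdist u (val z) by rewrite uz leqNgt t2.
rewrite card_tri; apply: leq_sum => i _; rewrite ffunE inE.
case: ifP => [/and3P[xy xr yr]|//].
by case: (bz i) => ->; rewrite ?xy ?xr.
Qed.

Lemma daisy2_cross_walk r x y (u v : {z : V | z \in daisy H r [set x; y]}) :
  #|tri r x y| <= 1 ->
  (forall i, val u i = r i \/ val u i = x i) ->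
  (forall i, val v i = r i \/ val v i = y i) ->
  has_walk (@induced _ H _) u v (hdist (val u) (val v)).
Proof.
move=> t1; case: u v => [u uS] [v vS] /= bu bv.
(* The geodesic runs from [u] to [w] in the box of [x], crosses to [w'], and continues to [v] in the
   box of [y]. *)
pose w : V := [ffun i : 'I_n => if v i == r i then r i else u i].
pose w' : V := [ffun i : 'I_n => if w i == r i then r i else v i].
have bw i : w i = r i \/ w i = x i.
  by rewrite ffunE; case: eqP => _; [left|apply: bu].
have bw' i : w' i = r i \/ w' i = y i.
  by rewrite ffunE; case: eqP => _; [left|apply: bv].
have wS : w \in daisy H r [set x; y] by apply/mem_daisy2; left.
have wS' : w' \in daisy H r [set x; y] by apply/mem_daisy2; right.
(* At such a coordinate [w] and [v] both differ from the root, hence have the values of [x] and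
   [y]. *)
have ww' i : w i != w' i -> i \in tri r x y.
  rewrite inE [w' i]ffunE; have [->|wr] := eqVneq (w i) (r i).
    by rewrite eqxx.
  have -> : x i = w i by case: (bw i) => // e; rewrite e eqxx in wr.
  have vr : v i != r i.
    by apply: contraNneq wr => vr; rewrite ffunE vr eqxx.
  have -> : y i = v i by case: (bv i) => // e; rewrite e eqxx in vr.
  by rewrite wr vr => ->.
have -> : hdist u v = hdist u w + hdist w w' + hdist w' v.
  apply/eqP; rewrite eq_sym -addnA.
  have /hdist_between/eqP-> : forall i, w' i = w i \/ w' i = v i.
    by move=> i; rewrite ffunE; case: eqP => [->|_]; [left|right].
  apply/hdist_between => i.
  by rewrite ffunE; case: eqP => [->|_]; [right|left].
apply: (@has_walk_cat _ _ _ (Sub w' wS')).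
  apply: (@has_walk_cat _ _ _ (Sub w wS)).
    apply: (@box_walk _ (Sub u uS) (Sub w wS)) => z bz; apply/mem_daisy2; left=> i.
    by case: (bz i) => ->; [apply: bu | apply: bw].
  apply: (@box_walk _ (Sub w wS) (Sub w' wS')) => z /= bz.
  (* With at most one differing coordinate, the box between [w] and [w'] contains only these two
     vertices. *)
  have {}t1 i j : w i != w' i -> w j != w' j -> i = j.
    by move=> /ww' it /ww' jt; move/card_le1_eqP: t1; apply.
  have [/existsP[i /andP[wi zi]]|] := boolP [exists i, (w i != w' i) && (z i == w i)].
    suff -> : z = w by [].
    apply/ffunP => j; case: (bz j) => // zj; rewrite zj.
    apply/eqP; rewrite eq_sym; apply: contraTT zi => wj.
    by rewrite (t1 _ _ wi wj) zj eq_sym.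
  rewrite negb_exists => /forallP h.
  suff -> : z = w' by [].
  apply/ffunP => j; case: (bz j) => // zj; have := h j.
  by rewrite zj eqxx andbT negbK => /eqP.
apply: (@box_walk _ (Sub w' wS') (Sub v vS)) => z bz; apply/mem_daisy2; right=> i.
by case: (bz i) => ->; [apply: bw' | apply: bv].
Qed.

Lemma daisy2_walk r x y (u v : {z : V | z \in daisy H r [set x; y]}) :
  #|tri r x y| <= 1 ->
  has_walk (@induced _ H _) u v (hdist (val u) (val v)).
Proof.
move=> t1; have t1' : #|tri r y x| <= 1 by rewrite triC.
case/mem_daisy2: (valP u) => bu; case/mem_daisy2: (valP v) => bv.
- apply: box_walk => z bz; apply/mem_daisy2; left=> i.
  by case: (bz i) => ->; [apply: bu | apply: bv].
- exact: daisy2_cross_walk.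
(* The types of [u] and [v] mention the generating set, so both are generalized before the
   generators are exchanged. *)
- move: u v bu bv; rewrite -daisy2C => u v bu bv; exact: daisy2_cross_walk.
- apply: box_walk => z bz; apply/mem_daisy2; right=> i.
  by case: (bz i) => ->; [apply: bu | apply: bv].
Qed.

Lemma tri_le1_isometric r x y :
  #|tri r x y| <= 1 -> isometric H (daisy H r [set x; y]).
Proof.
move=> t1 u v; rewrite gdist_hamming; apply: gdist_eq; first exact: daisy2_walk.
by move=> m /has_walk_induced /hdist_walk.
Qed.

End Hamming.

(* The pseudo-median is taken with respect to the metric of H and its three
   vertices are required to lie in G. *)
Theorem theorem2p12 (n : nat) (k : 'I_n -> nat) (k_gt0 : forall i, 0 < k i)
    (x y : hvertex k) (xDy : x <> y) :
  let H := @hamming n k in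
  let G := daisy H (hroot k_gt0) [set x; y] in
  isometric H G <->
  exists a b c : hvertex k,
    [/\ a \in G, b \in G, c \in G,
        pseudo_median H x y (hroot k_gt0) a b c &
        gdist H a b = 0 \/ gdist H a b = 1].
Proof.
move=> H G; set r := hroot k_gt0; split=> [/isometric_tri_le1 t1|].
  have [aG bG cG] := majority_daisy r x y.
  exists (majority x y r), (majority y x r), (majority r x y); split=> //.
    exact: majority_pseudo_median.
  rewrite gdist_hamming hdist_majority.
  by case: #|_| t1 => [|[|]] //; [left|right].
(* The size of any candidate bounds [#|tri r x y|] from above. *)
move=> [a [b [c [_ _ _ [/candidate_size_ge t1 _] ab]]]].
apply: tri_le1_isometric; apply: leq_trans t1 _.
by rewrite -gdist_hamming; case: ab => ->.
Qed.
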